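(* Let $k,l\ge 0$, let $G$ be a geometric graph of dimension $k$ and let $H$ be a geometric graph of dimension $l$. Then $G\times H$ is a geometric graph of dimension $k+l$.
   Context: All graphs are finite and simple. The unit sphere $S(x)$ of a vertex $x$ is the subgraph induced on the neighbors of $x$. Contractible (inductively): $K_1$ is contractible; a graph $G$ is contractible if there is a vertex $x$ such that both $S(x)$ and $G\setminus\{x\}$ (remove $x$ and its edges) are contractible. Spheres and geometric graphs (inductively): the empty graph is the $(-1)$-sphere. For $k\ge0$, a nonempty graph is geometric of dimension $k$ if for every vertex $x$ the unit sphere $S(x)$ is a $(k-1)$-sphere. For $k\ge 0$, a $k$-sphere is a geometric graph of dimension $k$ such that removing any vertex yields a contractible graph. Product: $G\times H$ has as vertices all pairs $(x,y)$ with $x$ a nonempty complete subgraph (simplex, identified with its vertex set) of $G$ and $y$ a nonempty complete subgraph of $H$. Two distinct vertices $(x,y)\neq(x',y')$ are adjacent iff ($x\subseteq x'$ and $y\subseteq y'$) or ($x'\subseteq x$ and $y'\subseteq y$). *)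

(* Defs.v *)
From mathcomp Require Import all_boot.

Set Implicit Arguments.
Unset Strict Implicit.
Unset Printing Implicit Defensive.

Record sgraph := SGraph {
  vertex :> finType;
  adj : rel vertex;
  adj_sym : symmetric adj;
  adj_irrefl : irreflexive adj }.

(* Every graph met in the recursive definitions below is an induced subgraph
   of the ambient graph G, and is represented by its set of vertices
   A : {set G}; the graph G itself is [set: G]. *)
Section InducedSubgraphs.
Variable G : sgraph.
Implicit Types (A : {set G}) (x : G).

Definition unit_sphere A x : {set G} := [set y in A | adj x y].

Inductive contractible : {set G} -> Prop :=
| contractible_K1 x : contractible [set x]
| contractible_step A x : x \in A ->
    contractible (unit_sphere A x) -> contractible (A :\ x) -> contractible A.

Definition nonempty_with_unit_spheres (P : {set G} -> Prop) A : Prop :=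
  A <> set0 /\ forall x, x \in A -> P (unit_sphere A x).

(* The index is the dimension plus one: sphere_succ n A says that A induces an
   (n - 1)-sphere, so that n = 0 is the (-1)-sphere, i.e. the empty graph. *)
Fixpoint sphere_succ (n : nat) A : Prop :=
  if n is k.+1 then
    nonempty_with_unit_spheres (sphere_succ k) A /\
    (forall x, x \in A -> contractible (A :\ x))
  else A = set0.

(* Unit spheres are (k - 1)-spheres, whence the index k of sphere_succ. *)
Definition geometric_on (k : nat) A : Prop :=
  nonempty_with_unit_spheres (sphere_succ k) A.

Definition is_simplex (s : {set G}) : bool :=
  (s != set0) && [forall x in s, forall y in s, (x != y) ==> adj x y].

End InducedSubgraphs.

Definition geometric (k : nat) (G : sgraph) : Prop := geometric_on k [set: G].

Definition simplex (G : sgraph) : finType := {s : {set G} | is_simplex s}.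

Section Product.
Variables G H : sgraph.

Definition sub_pair (p q : simplex G * simplex H) : bool :=
  (val p.1 \subset val q.1) && (val p.2 \subset val q.2).

Definition prod_adj : rel (simplex G * simplex H) :=
  fun p q => (p != q) && (sub_pair p q || sub_pair q p).

Lemma prod_adj_sym : symmetric prod_adj.
Proof. by move=> p q; rewrite /prod_adj eq_sym orbC. Qed.

Lemma prod_adj_irrefl : irreflexive prod_adj.
Proof. by move=> p; rewrite /prod_adj eqxx. Qed.

Definition prod_graph : sgraph := SGraph prod_adj_sym prod_adj_irrefl.

End Product.

(* Main.v *)
Require Import Defs.
From mathcomp Require Import all_boot.

Set Implicit Arguments.
Unset Strict Implicit.
Unset Printing Implicit Defensive.

(** The unit sphere of (x, y) in G x H is the join of the set of pairs below
    (x, y) and the set of pairs above it.  The pairs above are the barycentric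
    subdivision of the join of the links of x and y, and, after passing to
    complements, the pairs below are the barycentric subdivision of the join of
    the boundaries of the simplices x and y.  It remains to see that, for
    simplicial complexes, joins, boundaries of simplices and barycentric
    subdivisions yield spheres.  In the subdivision of a sphere K, the link of
    a simplex s is the join of the subdivisions of the boundary of s and of the
    link of s.  To contract the subdivision with s removed, pick a vertex v
    of s, remove first v, whose link is handled by induction on the dimension,
    then the other simplices containing v by increasing size, whose links are
    cones; what remains is the subdivision of K minus v. *)

(** * Cones and joins in graphs *)

Section Graphs.
Variable G : sgraph.
Implicit Types (A B : {set G}) (x : G).

Lemma card_unit_sphere A x : x \in A -> #|unit_sphere A x| < #|A|.
Proof.
move=> xA; apply/proper_card/properP; split.
  by apply/subsetP=> y; rewrite inE => /andP[].
by exists x; rewrite // inE xA adj_irrefl.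
Qed.

Lemma card_setD1_lt (T : finType) (X : {set T}) (x : T) : x \in X -> #|X :\ x| < #|X|.
Proof. by move=> xX; rewrite [ltnRHS](cardsD1 x) xX. Qed.

(** Any vertex other than the apex can be removed first: its unit sphere and the remainder are
    smaller cones with the same apex. *)
Lemma contractible_cone A c : c \in A ->
  {in A, forall x, x != c -> adj c x} -> contractible A.
Proof.
elim: {A}_.+1 {-2}A (ltnSn #|A|) => // n IHn A; rewrite ltnS => leA cA coneA.
have [/eqP|] := boolP (A :\ c == set0).
  move/(congr1 (fun X => c |: X)); rewrite setD1K // setU0 => ->.
  exact: contractible_K1.
case/set0Pn=> x; rewrite !inE => /andP[xc xA].
apply: (contractible_step xA).
  apply: IHn (leq_trans (card_unit_sphere xA) leA) _ _.
    by rewrite inE cA adj_sym coneA.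
  by move=> y; rewrite inE => /andP[yA _]; apply: coneA.
apply: IHn (leq_trans (card_setD1_lt xA) leA) _ _.
  by rewrite !inE eq_sym xc.
by move=> y; rewrite !inE => /andP[_ yA]; apply: coneA.
Qed.

Definition completely_adjacent A B := {in A & B, forall x y, adj x y}.

Lemma completely_adjacentC A B : completely_adjacent A B -> completely_adjacent B A.
Proof. by move=> AB x y xB yA; rewrite adj_sym AB. Qed.

Lemma unit_sphereU A B x : completely_adjacent A B -> x \in A ->
  unit_sphere (A :|: B) x = unit_sphere A x :|: B.
Proof.
move=> AB xA; apply/setP=> y; rewrite !inE.
by have [yB|] := boolP (y \in B); rewrite ?orbT ?orbF // AB.
Qed.

Lemma setD1_join A B x : completely_adjacent A B -> x \in A ->
  (A :|: B) :\ x = (A :\ x) :|: B.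
Proof.
move=> AB xA; apply/setP=> y; rewrite !inE.
have [yB|] := boolP (y \in B); rewrite ?orbT ?orbF //= andbT.
by apply: contraTneq (AB _ _ xA yB) => ->; rewrite adj_irrefl.
Qed.

(** A contraction of A also contracts the join: at each step the unit sphere and the remainder are
    joins with B, and over a single point the join is a cone. *)
Lemma contractible_join A B : contractible A -> completely_adjacent A B ->
  contractible (A :|: B).
Proof.
elim=> {A} [x|A x xA _ IHs _ IHd] AB.
  apply: (@contractible_cone _ x); first by rewrite !inE eqxx.
  move=> y; rewrite !inE => /orP[/eqP->|yB _]; first by rewrite eqxx.
  by rewrite AB ?inE.
apply: (@contractible_step _ _ x); first by rewrite inE xA.
  rewrite unit_sphereU //; apply: IHs => a b; rewrite inE => /andP[aA _].
  exact: AB.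
rewrite setD1_join //; apply: IHd => a b; rewrite !inE => /andP[_ aA].
exact: AB.
Qed.

(** Indices are dimensions plus one, so they add up under joins. Taking a unit sphere or removing a
    vertex changes only the side that contains the vertex. *)
Lemma sphere_succ_join p q A B : sphere_succ p A -> sphere_succ q B ->
  completely_adjacent A B -> sphere_succ (p + q) (A :|: B).
Proof.
move def_n: (p + q) => n; elim: n p q A B def_n => [|n IHn] p q A B.
  by case: p q => [|//] [|//] _ /= -> -> _; rewrite setU0.
move=> def_n sA sB AB.
(* Generalized over both sides, so that it also handles the vertices of B once the roles are
   exchanged. *)
have half p' q' A' B' x : p' + q' = n.+1 -> sphere_succ p' A' -> sphere_succ q' B' ->
    completely_adjacent A' B' -> x \in A' ->
    sphere_succ n (unit_sphere (A' :|: B') x) /\ contractible ((A' :|: B') :\ x).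
  case: p' => [_ ->|p']; first by rewrite inE.
  rewrite addSn => -[def_n'] [[_ sS] cD] sB' AB' xA'.
  rewrite unit_sphereU // setD1_join //; split.
    apply: (IHn p' q') => //; first exact: sS.
    by move=> a b; rewrite inE => /andP[aA _]; apply: AB'.
  apply: contractible_join; first exact: cD.
  by move=> a b; rewrite !inE => /andP[_ aA]; apply: AB'.
have all_x x : x \in A :|: B ->
    sphere_succ n (unit_sphere (A :|: B) x) /\ contractible ((A :|: B) :\ x).
  rewrite inE => /orP[xA|xB]; first exact: (half p q).
  rewrite setUC; apply: (half q p) => //; first by rewrite addnC.
  exact: completely_adjacentC.
split; last by move=> x /all_x[].
split; last by move=> x /all_x[].
case: p def_n sA {half all_x} => [|p] def_n sA.
  by move: def_n sB; rewrite add0n => -> [[B0 _] _]; rewrite sA set0U.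
by case: sA => -[A0 _] _ /eqP; rewrite setU_eq0 => /andP[/eqP].
Qed.

End Graphs.

(** * Simplicial complexes, nonevasiveness and combinatorial spheres *)

Section Complexes.
Variable T : finType.
Implicit Types (K : {set {set T}}) (s t : {set T}) (v : T).

(** The empty face is always present, so that the link of a maximal face is [[set set0]], the
    (-1)-sphere. *)
Definition complex K :=
  set0 \in K /\ forall s t, s \subset t -> t \in K -> s \in K.

Definition link K s : {set {set T}} := [set t : {set T} | [disjoint s & t] & s :|: t \in K].

Definition deletion K v : {set {set T}} := [set s in K | v \notin s].

(* For clique complexes of graphs this is [contractible]; the boundary of a
   simplex, needed below, is not a clique complex. *)
Inductive nonevasive : {set {set T}} -> Prop :=
| nonevasive_pt v : nonevasive [set set0; [set v]]
| nonevasive_step K v : [set v] \in K ->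
    nonevasive (link K [set v]) -> nonevasive (deletion K v) -> nonevasive K.

(* As in [sphere_succ], the index is the dimension plus one. *)
Fixpoint csphere (n : nat) K : Prop :=
  if n is m.+1 then
    (exists v, [set v] \in K) /\
    (forall v, [set v] \in K ->
       csphere m (link K [set v]) /\ nonevasive (deletion K v))
  else K = [set set0].

Definition full_simplex s : {set {set T}} := [set t : {set T} | t \subset s].
Definition boundary s : {set {set T}} := [set t : {set T} | t \proper s].

Lemma link_complex K s : complex K -> s \in K -> complex (link K s).
Proof.
move=> [K0 downK] sK; split=> [|t u tu].
  by rewrite inE disjoints_subset setC0 subsetT setU0.
rewrite !inE => /andP[su suK]; rewrite (disjointWr tu su).
exact: downK (setUS _ tu) suK.
Qed.

Lemma deletion_complex K v : complex K -> complex (deletion K v).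
Proof.
move=> [K0 downK]; split=> [|t u tu]; first by rewrite !inE K0.
rewrite !inE => /andP[uK vu]; rewrite (downK _ _ tu uK) /=.
by apply: contra vu; apply: subsetP.
Qed.

Lemma link_set0 K : link K set0 = K.
Proof. by apply/setP=> t; rewrite inE set0U disjoints_subset sub0set. Qed.

Lemma link_link K s t : [disjoint s & t] -> link (link K s) t = link K (s :|: t).
Proof.
move=> st; apply/setP=> u; rewrite !inE setUA andbA; congr (_ && _).
by rewrite -!setI_eq0 setIUr setIUl !setU_eq0 !setI_eq0 st andbC.
Qed.

Lemma boundary_complex s : s != set0 -> complex (boundary s).
Proof.
move=> s0; split=> [|t u tu]; first by rewrite inE properE sub0set subset0.
by rewrite !inE => /(sub_proper_trans tu).
Qed.

(** The analogue of [contractible_cone], by induction on the number of faces: the link of v lies in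
    the deletion of v, which loses at least the face [[set v]]. *)
Lemma nonevasive_cone K c : complex K -> [set c] \in K ->
  {in K, forall s, c |: s \in K} -> nonevasive K.
Proof.
elim: {K}_.+1 {-2}K (ltnSn #|K|) => // n IHn K; rewrite ltnS => leK cK cc coneK.
have [|no_v] := pickP [pred v | (v != c) && ([set v] \in K)].
  move=> v /andP[vc vK].
  have ltd : #|deletion K v| < #|K|.
    apply/proper_card/properP; split; first by apply/subsetP=> s; rewrite inE => /andP[].
    by exists [set v]; rewrite // !inE eqxx andbF.
  have lkd : link K [set v] \subset deletion K v.
    apply/subsetP=> s; rewrite !inE disjoints1 => /andP[-> vsK]; rewrite andbT.
    exact: (cK.2 _ _ (subsetUr _ _) vsK).
  have disc s : v \notin s -> v \notin c |: s by rewrite !inE (negPf vc).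
  apply: (nonevasive_step vK).
    apply: IHn; first exact: leq_trans (leq_ltn_trans (subset_leq_card lkd) ltd) leK.
    - exact: link_complex.
    - by rewrite !inE disjoints1 inE vc setUC coneK.
    move=> s; rewrite !inE !disjoints1 => /andP[/disc-> vsK] /=.
    by rewrite setUCA coneK.
  apply: IHn; first exact: leq_trans ltd leK.
  - exact: deletion_complex.
  - by rewrite !inE cc vc.
  by move=> s; rewrite inE => /andP[/coneK csK /disc vs]; rewrite inE csK.
suffices -> : K = [set set0; [set c]] by apply: nonevasive_pt.
apply/setP=> s; rewrite !inE.
apply/idP/orP=> [sK|[/eqP->|/eqP->//]]; last by case: cK.
apply/orP; rewrite orbC -subset1; apply/subsetP=> v vs; rewrite inE; apply/idPn=> vc.
by have := no_v v; rewrite /= vc (cK.2 _ s) // sub1set.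
Qed.

(** The link of u is the boundary of [s :\ u], and deleting u leaves the full simplex on [s :\ u], a
    cone over any of its vertices. *)
Lemma csphere_boundary n s : #|s| = n.+1 -> csphere n (boundary s).
Proof.
elim: n s => [|n IHn] s /=.
  move/eqP/cards1P=> [v ->]; apply/setP=> t.
  by rewrite !inE properEcard cards1 ltnS leqn0 cards_eq0 andb_idl // => /eqP->; apply: sub0set.
move=> ns; have [v vs] : exists v, v \in s by apply/card_gt0P; rewrite ns.
have v1 u : u \in s -> [set u] \proper s by move=> us; rewrite properEcard sub1set us cards1 ns.
split=> [|u]; first by exists v; rewrite inE v1.
rewrite inE => /proper_sub; rewrite sub1set => us.
have ns' : #|s :\ u| = n.+1 by move: ns; rewrite (cardsD1 u) us => -[].
split.
  suffices -> : link (boundary s) [set u] = boundary (s :\ u) by apply: IHn.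
  apply/setP=> t; rewrite !inE disjoints1.
  have [ut|ut] /= := boolP (u \in t).
    apply/esym/negbTE; apply: contraL ut => /proper_sub/subsetP sub.
    by apply/negP=> /sub; rewrite !inE eqxx.
  rewrite !properEcard ns ns' cardsU1 ut subUset sub1set us ltnS /=.
  by rewrite subsetD1 ut andbT.
have [c cs] : exists c, c \in s :\ u by apply/card_gt0P; rewrite ns'.
have -> : deletion (boundary s) u = full_simplex (s :\ u).
  apply/setP=> t; rewrite !inE subsetD1 properEneq.
  have [ut|ut] /= := boolP (u \in t); rewrite ?andbF ?andbT //.
  by apply: andb_idl => _; apply: contraNneq ut => ->.
apply: (@nonevasive_cone _ c); rewrite /complex.
- split=> [|t t' tt']; rewrite !inE ?sub0set //; exact: subset_trans.
- by rewrite inE sub1set.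
by move=> t; rewrite !inE subUset sub1set => ->; rewrite cs.
Qed.

(** The link of a face is an iterated vertex link, and each vertex lowers the index by one. The
    bound on [#|s|] makes the subtraction exact. *)
Lemma csphere_link n K s : complex K -> csphere n K -> s \in K ->
  #|s| <= n /\ csphere (n - #|s|) (link K s).
Proof.
elim: n K s => [|n IHn] K s cK.
  by move=> /= K0; rewrite {1}K0 inE => /eqP->; rewrite cards0 link_set0.
have [->|] := eqVneq s set0; first by rewrite cards0 link_set0.
case/set0Pn=> v vs sph sK; have vK : [set v] \in K by apply: cK.2 sK; rewrite sub1set.
have [lk _] := sph.2 v vK.
have dv : [disjoint [set v] & s :\ v] by rewrite disjoints1 !inE eqxx.
have [] := IHn _ (s :\ v) (link_complex cK vK) lk.
  by rewrite inE dv setD1K.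
by rewrite link_link // setD1K // [#|s|](cardsD1 v) vs add1n ltnS subSS.
Qed.

End Complexes.

(** * Joins of simplicial complexes *)

Section Join.
Variables T1 T2 : finType.
Implicit Types (K : {set {set T1}}) (L : {set {set T2}}) (s t : {set T1 + T2}).

Definition left_part s : {set T1} := [set x | inl x \in s].
Definition right_part s : {set T2} := [set y | inr y \in s].

Definition sum_set (a : {set T1}) (b : {set T2}) : {set T1 + T2} :=
  [set z | match z with inl x => x \in a | inr y => y \in b end].

Definition cjoin K L : {set {set T1 + T2}} :=
  [set s | (left_part s \in K) && (right_part s \in L)].

Lemma left_sum_set a b : left_part (sum_set a b) = a.
Proof. by apply/setP=> x; rewrite !inE. Qed.

Lemma right_sum_set a b : right_part (sum_set a b) = b.
Proof. by apply/setP=> x; rewrite !inE. Qed.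

Lemma sum_set_eta s : sum_set (left_part s) (right_part s) = s.
Proof. by apply/setP=> -[x|y]; rewrite !inE. Qed.

Lemma sub_sum_set s t :
  (s \subset t) = (left_part s \subset left_part t) && (right_part s \subset right_part t).
Proof.
apply/subsetP/andP=> [st|[/subsetP sl /subsetP sr] [x|y] zs].
- by split; apply/subsetP=> x; rewrite !inE => /st.
- by have := sl x; rewrite !inE; apply.
- by have := sr y; rewrite !inE; apply.
Qed.

Lemma eq_sum_set s t : left_part s = left_part t -> right_part s = right_part t -> s = t.
Proof. by move=> e1 e2; rewrite -(sum_set_eta s) e1 e2 sum_set_eta. Qed.

Lemma disjoint_sum_set s t : [disjoint s & t] =
  [disjoint left_part s & left_part t] && [disjoint right_part s & right_part t].
Proof.
rewrite !disjoints_subset sub_sum_set.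
have -> : left_part (~: t) = ~: left_part t by apply/setP=> x; rewrite !inE.
by have -> : right_part (~: t) = ~: right_part t by apply/setP=> x; rewrite !inE.
Qed.

Lemma left_partU s t : left_part (s :|: t) = left_part s :|: left_part t.
Proof. by apply/setP=> x; rewrite !inE. Qed.

Lemma right_partU s t : right_part (s :|: t) = right_part s :|: right_part t.
Proof. by apply/setP=> x; rewrite !inE. Qed.

Lemma left_partD s t : left_part (s :\: t) = left_part s :\: left_part t.
Proof. by apply/setP=> x; rewrite !inE. Qed.

Lemma right_partD s t : right_part (s :\: t) = right_part s :\: right_part t.
Proof. by apply/setP=> x; rewrite !inE. Qed.

Lemma left_part_inl x : left_part [set inl x] = [set x].
Proof. by apply/setP=> z; rewrite !inE. Qed.

Lemma right_part_inl x : right_part [set inl x] = set0.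
Proof. by apply/setP=> z; rewrite !inE. Qed.

Lemma left_part_inr y : left_part [set inr y] = set0.
Proof. by apply/setP=> z; rewrite !inE. Qed.

Lemma right_part_inr y : right_part [set inr y] = [set y].
Proof. by apply/setP=> z; rewrite !inE. Qed.

Definition part_singE := (left_part_inl, right_part_inl, left_part_inr, right_part_inr).

Lemma left_part0 : left_part set0 = set0.
Proof. by apply/setP=> z; rewrite !inE. Qed.

Lemma right_part0 : right_part set0 = set0.
Proof. by apply/setP=> z; rewrite !inE. Qed.

Lemma link_cjoin K L s :
  link (cjoin K L) s = cjoin (link K (left_part s)) (link L (right_part s)).
Proof.
apply/setP=> t; rewrite !inE disjoint_sum_set left_partU right_partU.
by rewrite andbACA.
Qed.

Lemma deletion_cjoin_inl K L x : deletion (cjoin K L) (inl x) = cjoin (deletion K x) L.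
Proof. by apply/setP=> s; rewrite !inE andbAC. Qed.

Lemma deletion_cjoin_inr K L y : deletion (cjoin K L) (inr y) = cjoin K (deletion L y).
Proof. by apply/setP=> s; rewrite !inE -andbA. Qed.

Lemma cjoin_complex K L : complex K -> complex L -> complex (cjoin K L).
Proof.
move=> [K0 dK] [L0 dL]; split=> [|s t].
  by rewrite inE left_part0 right_part0 K0.
rewrite sub_sum_set !inE => /andP[sl sr] /andP[tK tL].
by rewrite (dK _ _ sl tK) (dL _ _ sr tL).
Qed.

Lemma point_complex (T : finType) (v : T) : complex [set set0; [set v]].
Proof.
split=> [|s t st]; rewrite !inE ?eqxx // => /orP[] /eqP def_t.
  by move: st; rewrite def_t subset0 => ->.
by move: st; rewrite def_t subset1 orbC.
Qed.

(** Link and deletion at [inl v] leave L untouched; when K is a point v, the join is a cone with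
    apex [inl v]. *)
Lemma nonevasive_cjoinl K L : nonevasive K -> complex L -> nonevasive (cjoin K L).
Proof.
elim=> {K} [v|K v vK _ IHl _ IHd] cL.
  apply: (@nonevasive_cone _ _ (inl v)).
  - exact: cjoin_complex (point_complex v) cL.
  - by rewrite inE !part_singE !inE eqxx orbT (proj1 cL).
  move=> s; rewrite !(inE, left_partU, right_partU, part_singE) set0U.
  by case/andP=> /orP[] /eqP-> ->; rewrite ?setU0 ?setUid eqxx orbT.
apply: (@nonevasive_step _ _ (inl v)).
- by rewrite inE !part_singE vK (proj1 cL).
- by rewrite link_cjoin !part_singE link_set0; apply: IHl.
by rewrite deletion_cjoin_inl; apply: IHd.
Qed.

Lemma nonevasive_cjoinr K L : nonevasive L -> complex K -> nonevasive (cjoin K L).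
Proof.
elim=> {L} [v|L v vL _ IHl _ IHd] cK.
  apply: (@nonevasive_cone _ _ (inr v)).
  - exact: cjoin_complex cK (point_complex v).
  - by rewrite inE !part_singE !inE eqxx orbT (proj1 cK).
  move=> s; rewrite !(inE, left_partU, right_partU, part_singE) set0U.
  by case/andP=> -> /orP[] /eqP->; rewrite ?setU0 ?setUid eqxx orbT.
apply: (@nonevasive_step _ _ (inr v)).
- by rewrite inE !part_singE vL (proj1 cK).
- by rewrite link_cjoin !part_singE link_set0; apply: IHl.
by rewrite deletion_cjoin_inr; apply: IHd.
Qed.

Lemma csphere_vertex (T : finType) n (K : {set {set T}}) v :
  csphere n K -> [set v] \in K -> exists m, n = m.+1.
Proof.
case: n => [-> |n _ _]; last by exists n.
by rewrite inE => /eqP e; have := set11 v; rewrite e inE.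
Qed.

(** A vertex of the join belongs to one factor, and its link and deletion are the joins of those in
    that factor with the other factor. *)
Lemma csphere_cjoin p q K L : complex K -> complex L -> csphere p K -> csphere q L ->
  csphere (p + q) (cjoin K L).
Proof.
move def_n: (p + q) => n; elim: n p q K L def_n => [|n IHn] p q K L.
  case: p q => [|//] [|//] _ cK cL /= -> ->; apply/setP=> s; rewrite !inE.
  apply/andP/eqP=> [[/eqP s1 /eqP s2]|->]; last by rewrite left_part0 right_part0.
  by apply: eq_sum_set; rewrite ?left_part0 ?right_part0.
move=> def_n cK cL sK sL; split.
  case: p def_n sK => [def_n _|p _ [[v vK] _]]; last first.
    by exists (inl v); rewrite inE !part_singE vK (proj1 cL).
  move: def_n sL; rewrite add0n => -> [[v vL] _].
  by exists (inr v); rewrite inE !part_singE vL (proj1 cK).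
case=> v; rewrite inE !part_singE => /andP[vK vL];
  rewrite link_cjoin !part_singE !link_set0.
  have [p' def_p] := csphere_vertex sK vK; move: def_n sK.
  rewrite def_p addSn => -[def_n] sK; have [lk del] := sK.2 v vK.
  split; last by rewrite deletion_cjoin_inl; apply: nonevasive_cjoinl.
  exact: (IHn p' q) (link_complex cK vK) cL lk sL.
have [q' def_q] := csphere_vertex sL vL; move: def_n sL.
rewrite def_q addnS => -[def_n] sL; have [lk del] := sL.2 v vL.
split; last by rewrite deletion_cjoin_inr; apply: nonevasive_cjoinr.
exact: (IHn p q') cK (link_complex cL vL) sK lk.
Qed.

End Join.

(** * Barycentric subdivisions as labelled graphs *)

Section Subdivision.
Variables (G : sgraph) (T : finType).
Implicit Types (A B : {set G}) (a b c : G) (lab : G -> {set T}).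
Implicit Types (K L : {set {set T}}) (s : {set T}) (v : T).

(** The comparability graph of a family of distinct sets ordered by inclusion. *)
Definition inclusion_graph A lab : Prop :=
  {in A &, injective lab} /\
  {in A &, forall a b,
     adj a b = (a != b) && ((lab a \subset lab b) || (lab b \subset lab a))}.

(* Through the labels, A induces the barycentric subdivision of K.  Labels avoid
   transporting contractibility along isomorphisms: links in the subdivision
   are relabelled in place. *)
Definition subdivides A lab K : Prop :=
  inclusion_graph A lab /\ lab @: A = K :\ set0.

Lemma inclusion_graphS A B lab : B \subset A -> inclusion_graph A lab ->
  inclusion_graph B lab.
Proof.
by move=> /subsetP BA [inj adjE]; split=> b c /BA bA /BA cA; [apply: inj | apply: adjE].
Qed.

Lemma subdividesP A lab K a : subdivides A lab K -> a \in A ->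
  lab a \in K /\ lab a != set0.
Proof.
by move=> [_ im] aA; have := imset_f lab aA; rewrite im !inE => /andP[].
Qed.

Lemma subdivides_ex A lab K s : subdivides A lab K -> s \in K -> s != set0 ->
  exists2 a, a \in A & lab a = s.
Proof.
move=> [_ im] sK s0; have : s \in lab @: A by rewrite im !inE s0.
by case/imsetP=> a aA ->; exists a.
Qed.

(** Common core of the cases of boundaries and deletions. Only nonempty faces are compared, since
    the empty set is never a label. *)
Lemma subdivides_sub A lab K (P : pred {set T}) L : subdivides A lab K ->
  (forall s, (s \in L) && (s != set0) = [&& s \in K, s != set0 & P s]) ->
  subdivides [set a in A | P (lab a)] lab L.
Proof.
move=> sd LE; split.
  by apply: inclusion_graphS sd.1; apply/subsetP=> a; rewrite inE => /andP[].
apply/setP=> s; rewrite !inE andbC LE.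
apply/imsetP/and3P=> [[a]|[sK s0 Ps]].
  by rewrite inE => /andP[aA Pa] ->; have [] := subdividesP sd aA.
by have [a aA def_s] := subdivides_ex sd sK s0; exists a; rewrite // inE aA def_s.
Qed.

Lemma subdivides_lower A lab K s : complex K -> s \in K -> subdivides A lab K ->
  subdivides [set a in A | lab a \proper s] lab (boundary s).
Proof.
move=> [_ dK] sK sd; apply: (subdivides_sub (P := fun t => t \proper s)) sd _ => t.
rewrite inE; have [ts|] := boolP (t \proper s); rewrite ?andbF // andbT.
by rewrite (dK _ _ (proper_sub ts) sK).
Qed.

Lemma subdivides_deletion A lab K v : subdivides A lab K ->
  subdivides [set a in A | v \notin lab a] lab (deletion K v).
Proof.
move=> sd; apply: (subdivides_sub (P := fun t => v \notin t)) sd _ => t.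
by rewrite inE -andbA [(v \notin t) && _]andbC.
Qed.

Lemma setUDK (s t : {set T}) : s \subset t -> s :|: t :\: s = t.
Proof. by move=> st; rewrite -[RHS](setID t s) (setIidPr st). Qed.

(** Removing s is an order isomorphism from the faces strictly containing s to the nonempty faces of
    its link. Surjectivity is asked only above s, so that the lemma applies to products, whose
    labels have both parts nonempty. *)
Lemma subdivides_upper A lab K s : inclusion_graph A lab ->
  {in A, forall a, lab a \in K} ->
  (forall t, t \in K -> s \proper t -> exists2 a, a \in A & lab a = t) ->
  subdivides [set a in A | s \proper lab a] (fun a => lab a :\: s) (link K s).
Proof.
move=> [inj adjE] labK surj; split; first split.
- move=> a b; rewrite !inE => /andP[aA /proper_sub sa] /andP[bA /proper_sub sb] eq_ab.
  by apply: inj => //; rewrite -(setUDK sa) eq_ab setUDK.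
- move=> a b; rewrite !inE => /andP[aA /proper_sub sa] /andP[bA /proper_sub sb].
  by rewrite adjE // !subDset !setUDK.
apply/setP=> t; rewrite !inE; apply/imsetP/and3P=> [[a]|[t0 st stK]].
  rewrite inE => /andP[aA sa] ->; rewrite setUDK ?proper_sub //; split.
  - by apply: contraTneq sa => /eqP; rewrite setD_eq0 properE => ->; rewrite andbF.
  - by rewrite disjoint_sym disjoints_subset setDE subsetIr.
  exact: labK.
have sub : s \proper s :|: t.
  rewrite properE subsetUl; apply: contra t0.
  by rewrite subUset subxx /= => ts; rewrite -(setIidPr ts) setI_eq0.
have [a aA def_a] := surj _ stK sub.
exists a; first by rewrite inE aA def_a.
by rewrite def_a setDUl setDv set0U; apply/esym/setDidPl; rewrite disjoint_sym.
Qed.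

Lemma subdivides_link A lab K s : subdivides A lab K ->
  subdivides [set a in A | s \proper lab a] (fun a => lab a :\: s) (link K s).
Proof.
move=> sd; apply: subdivides_upper sd.1 _ _ => [a aA|t tK st].
  by case: (subdividesP sd aA).
apply: subdivides_ex sd tK _; apply: contraTneq st => ->.
by rewrite properE sub0set andbF.
Qed.

Lemma unit_sphere_inclusion A lab a : inclusion_graph A lab -> a \in A ->
  unit_sphere A a =
    [set b in A | lab b \proper lab a] :|: [set b in A | lab a \proper lab b].
Proof.
move=> [inj adjE] aA; apply/setP=> b; rewrite !inE.
have [bA|//] := boolP (b \in A); rewrite /= adjE // !properEneq -(inj_in_eq inj) //.
by rewrite [lab b == _]eq_sym -andb_orr orbC.
Qed.

(** Below a singleton there is only the empty set, which is not a label. *)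
Lemma unit_sphere_vertex A lab K a v : subdivides A lab K -> a \in A ->
  lab a = [set v] -> unit_sphere A a = [set b in A | [set v] \proper lab b].
Proof.
move=> sd aA def_a; rewrite (unit_sphere_inclusion sd.1) // def_a.
apply/setP=> b; rewrite !inE; have [bA|//] := boolP (b \in A).
have [_] := subdividesP sd bA; rewrite /= properE subset1.
by move/negPf->; case: eqP => [->|_]; rewrite ?subxx.
Qed.

(* When the elements whose label contains v are removed by increasing label, the
   link of such an element a is a cone with apex c, where lab c = lab a :\ v. *)
Lemma contractible_strip A lab v : inclusion_graph A lab ->
  (forall a, a \in A -> v \in lab a -> exists2 c, c \in A & lab c = lab a :\ v) ->
  contractible [set a in A | v \notin lab a] -> contractible A.
Proof.
elim: {A}_.+1 {-2}A (ltnSn #|A|) => // n IHn A; rewrite ltnS => leA igA closedA ctr.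
have [none|[a0 a0A va0]] : [set a in A | v \notin lab a] = A \/
    exists2 a, a \in A & v \in lab a.
  have [/exists_inP|] := boolP [exists a in A, v \in lab a]; first by right.
  rewrite negb_exists_in => /forall_inP notv; left; apply/setP=> a; rewrite inE.
  exact: andb_idr (notv a).
- by rewrite -none.
have Pa0 : [pred a in A | v \in lab a] a0 by rewrite /= a0A.
case: (arg_minnP (fun a => #|lab a|) Pa0) => a /andP[aA va] min_a.
have [inj adjE] := igA; have [c cA def_c] := closedA a aA va.
have ca : lab c \proper lab a by rewrite def_c properD1.
have sphE := unit_sphere_inclusion igA aA.
apply: (contractible_step aA).
  apply: (@contractible_cone _ _ c); rewrite sphE; first by rewrite !inE cA ca.
  move=> b; rewrite !inE => bS bc; have bA : b \in A by case/orP: bS => /andP[].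
  rewrite adjE // eq_sym bc /=; case/orP: bS => /andP[_].
    move=> ba; rewrite [X in _ || X](_ : _ = true) ?orbT //.
    (* A smaller label containing v would contradict the minimal size of [lab a]; so [lab b] avoids
       v and lies in [lab c]. *)
    rewrite def_c subsetD1 proper_sub //=; apply/negP=> vb.
    have := min_a b; rewrite inE /= bA vb => /(_ isT).
    by rewrite leqNgt proper_card.
  by move/proper_sub=> ab; rewrite (subset_trans (proper_sub ca) ab).
apply: IHn; first exact: leq_trans (card_setD1_lt aA) leA.
- by apply: inclusion_graphS igA; apply: subD1set.
- move=> b; rewrite !inE => /andP[_ bA] vb; have [d dA def_d] := closedA b bA vb.
  exists d; rewrite // !inE dA andbT; apply: contraTneq va => <-.
  by rewrite def_d !inE eqxx.
rewrite (_ : [set _ in _ | _] = [set b in A | v \notin lab b]) //.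
apply/setP=> b; rewrite !inE; case: eqP => [->|//].
by rewrite /= va andbF.
Qed.

(** Once the label [[set v]] is gone, every label containing v stays nonempty without v, so the
    apexes required by [contractible_strip] exist in B. *)
Lemma contractible_strip_vertex A B lab K v : complex K -> subdivides A lab K ->
  contractible [set a in A | v \notin lab a] -> B \subset A ->
  {in A, forall a, v \notin lab a -> a \in B} -> {in B, forall a, lab a != [set v]} ->
  contractible B.
Proof.
move=> cK sd ctr BA keepB no_v; apply: (contractible_strip (v := v)).
- exact: inclusion_graphS BA sd.1.
- move=> b bB vb; have [bK _] := subdividesP sd (subsetP BA b bB).
  have [||c cA def_c] := @subdivides_ex _ _ _ (lab b :\ v) sd.
  + exact: cK.2 (subD1set _ _) bK.
  + apply: contra (no_v b bB) => /eqP b0.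
    by rewrite -(setD1K vb) b0 setU0.
  exists c; rewrite // keepB // def_c.
  by rewrite !inE eqxx.
rewrite (_ : [set _ in _ | _] = [set a in A | v \notin lab a]) //.
apply/setP=> b; rewrite !inE; apply/andP/andP=> -[bAB vb]; split=> //.
  exact: (subsetP BA).
exact: keepB.
Qed.


(** A nonevasive step at v becomes the removal of the vertex labelled [[set v]], whose unit sphere
    subdivides the link of v, followed by the stripping of all other labels containing v. *)
Lemma contractible_subdivides K A lab : nonevasive K -> complex K ->
  subdivides A lab K -> contractible A.
Proof.
move=> evK; elim: evK A lab => {K} [v|K v vK _ IHl _ IHd] A lab cK sd.
  have [||a aA def_a] := @subdivides_ex _ _ _ [set v] sd; first by rewrite !inE eqxx orbT.
    by apply/set0Pn; exists v; rewrite inE.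
  suffices -> : A = [set a] by apply: contractible_K1.
  apply/setP=> b; rewrite inE; apply/idP/eqP=> [bA|->//].
  have [] := subdividesP sd bA; rewrite !inE => /orP[->//|/eqP def_b _].
  by apply: sd.1.1; rewrite // def_b.
have v0 : [set v] != set0 by apply/set0Pn; exists v; rewrite inE.
have [a aA def_a] := subdivides_ex sd vK v0.
apply: (contractible_step aA).
  rewrite (unit_sphere_vertex sd aA def_a).
  exact: IHl (link_complex cK vK) (subdivides_link _ sd).
apply: (contractible_strip_vertex (v := v) cK sd).
- exact: IHd (deletion_complex _ cK) (subdivides_deletion _ sd).
- exact: subD1set.
- move=> b bA vb; rewrite !inE bA andbT; apply: contraNneq vb => ->.
  by rewrite def_a inE.
move=> b; rewrite !inE => /andP[ba bA]; apply: contra ba => /eqP def_b.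
by apply/eqP/sd.1.1; rewrite ?def_a.
Qed.

Lemma contractible_subdivides_sphere n A lab K a : csphere n K -> complex K ->
  subdivides A lab K -> a \in A -> contractible (A :\ a).
Proof.
elim: n A lab K a => [|n IHn] A lab K a sK cK sd aA; have [aK a0] := subdividesP sd aA.
  by move: aK a0; rewrite {1}sK inE => ->.
have /set0Pn[v va] := a0.
have vK : [set v] \in K by apply: cK.2 aK; rewrite sub1set.
have v0 : [set v] != set0 by apply/set0Pn; exists v; rewrite inE.
have [c cA def_c] := subdivides_ex sd vK v0.
have [lk del] := sK.2 v vK.
(* Without a and c, the remaining labels containing v can be stripped, down to the subdivision of
   the nonevasive deletion of v. *)
have ctr : contractible ((A :\ a) :\ c).
  apply: (contractible_strip_vertex (v := v) cK sd).
  - exact: contractible_subdivides del (deletion_complex _ cK) (subdivides_deletion _ sd).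
  - exact: subset_trans (subD1set _ _) (subD1set _ _).
  - move=> b bA vb; rewrite !inE bA andbT.
    apply/andP; split; apply: contraNneq vb => -> //.
    by rewrite def_c inE.
  move=> b; rewrite !inE => /and3P[bc _ bA]; apply: contra bc => /eqP def_b.
  by apply/eqP/sd.1.1; rewrite ?def_c.
(* If [lab a] is [[set v]], then c is a and the proof is complete; otherwise c must be put back. *)
have [ca|ca] := eqVneq c a; first by move: ctr; rewrite ca setDDl setUid.
apply: contractible_step ctr; first by rewrite !inE ca.
have -> : unit_sphere (A :\ a) c = unit_sphere A c :\ a.
  by apply/setP=> b; rewrite !inE andbA.
rewrite (unit_sphere_vertex sd cA def_c).
(* After relabelling, a is a vertex of the subdivision of the link of v, a sphere of smaller
   dimension. *)
apply: (IHn _ _ (link K [set v])) lk (link_complex cK vK) (subdivides_link _ sd) _.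
rewrite inE aA properEneq sub1set va andbT.
by apply: contraNneq ca => va1; apply/eqP/sd.1.1; rewrite ?def_c.
Qed.

(** The unit sphere of a is the join of the subdivided boundary of [lab a] and the subdivided link
    of [lab a]. Both may drop by several dimensions, hence the strong induction. *)
Lemma sphere_subdivides n A lab K : csphere n K -> complex K ->
  subdivides A lab K -> sphere_succ n A.
Proof.
elim: {n}_.+1 {-2}n (ltnSn n) A lab K => // m IHm [|n] le_n A lab K sK cK sd.
  rewrite /=; apply/setP=> a; rewrite inE; apply/negP=> aA.
  by have [] := subdividesP sd aA; rewrite {1}sK inE => ->.
split; last by move=> a; apply: contractible_subdivides_sphere sK cK sd.
split=> [|a aA].
  have [[v vK] _] := sK; have [|a aA _] := subdivides_ex sd vK.
    by apply/set0Pn; exists v; rewrite inE.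
  by move=> A0; rewrite A0 inE in aA.
have [aK a0] := subdividesP sd aA; rewrite (unit_sphere_inclusion sd.1) //.
have [] := csphere_link cK sK aK.
case def_d: #|lab a| => [|d]; first by move/eqP: def_d a0; rewrite cards_eq0 => ->.
(* As [lab a] has [d.+1] elements, its boundary has index d and its link index [n - d]. *)
rewrite subSS ltnS => le_d lk; rewrite ltnS in le_n; rewrite -[n in sphere_succ n](subnKC le_d).
apply: sphere_succ_join.
- apply: IHm (csphere_boundary def_d) (boundary_complex a0) (subdivides_lower cK aK sd).
  exact: leq_ltn_trans le_d le_n.
- apply: IHm lk (link_complex cK aK) (subdivides_link _ sd).
  exact: leq_ltn_trans (leq_subr _ _) le_n.
move=> b c; rewrite !inE => /andP[bA ba] /andP[cA ac].
have bc := proper_trans ba ac; rewrite sd.1.2 // (proper_sub bc) andbT.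
by apply: contraTneq bc => ->; rewrite properxx.
Qed.

(** Complementation in s reverses inclusions, and comparability does not see the direction. *)
Lemma subdivides_complement A lab L s : inclusion_graph A lab ->
  {in A, forall a, lab a \proper s -> s :\: lab a \in L} ->
  (forall t, t \in L -> t != set0 ->
     t \subset s /\ exists2 a, a \in A & lab a = s :\: t) ->
  subdivides [set a in A | lab a \proper s] (fun a => s :\: lab a) L.
Proof.
move=> [inj adjE] labL surj.
have DK (t : {set T}) : t \subset s -> s :\: (s :\: t) = t.
  by move=> ts; rewrite setDDr setDv set0U (setIidPr ts).
have DS (t u : {set T}) : t \subset s -> u \subset s -> (s :\: t \subset s :\: u) = (u \subset t).
  by move=> ts us; apply/idP/idP=> sub; first rewrite -(DK t) // -(DK u) //; apply: setDS.
split; first split.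
- move=> a b; rewrite !inE => /andP[aA /proper_sub sa] /andP[bA /proper_sub sb] eq_ab.
  by apply: inj => //; rewrite -(DK (lab a)) // eq_ab DK.
- move=> a b; rewrite !inE => /andP[aA /proper_sub sa] /andP[bA /proper_sub sb].
  by rewrite adjE // !DS // orbC.
apply/setP=> t; rewrite !inE; apply/imsetP/andP=> [[a]|[t0 tL]].
  rewrite inE => /andP[aA sa] ->; split; last exact: labL.
  by move: sa; rewrite properE setD_eq0 => /andP[].
have [ts [a aA def_a]] := surj t tL t0; exists a; last by rewrite def_a DK.
rewrite inE aA def_a properE subsetDl /=; apply: contra t0 => sub.
by rewrite -(DK t ts) setD_eq0.
Qed.

End Subdivision.

(** * Clique complexes of graphs *)

Section Cliques.
Variable G : sgraph.
Implicit Types (A s : {set G}) (x y : G).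

(** Contains the empty clique, which [is_simplex] excludes, so as to be a [complex]. *)
Definition cliques A : {set {set G}} :=
  [set s : {set G} | (s \subset A) && [forall x in s, forall y in s, (x != y) ==> adj x y]].

Lemma cliquesP A s :
  reflect (s \subset A /\ {in s &, forall x y, x != y -> adj x y}) (s \in cliques A).
Proof.
rewrite inE; apply: (iffP andP) => -[sA cl]; split=> //.
  by move=> x y xs ys xy; move/forall_inP/(_ x xs)/forall_inP/(_ y ys)/implyP: cl; apply.
by apply/forall_inP=> x xs; apply/forall_inP=> y ys; apply/implyP; apply: cl.
Qed.

Lemma cliques_complex A : complex (cliques A).
Proof.
split=> [|s t st /cliquesP[tA cl]]; apply/cliquesP; split.
- exact: sub0set.
- by move=> x y; rewrite inE.
- exact: subset_trans tA.
by move=> x y /(subsetP st) xt /(subsetP st); apply: cl.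
Qed.

Lemma set1_cliques A x : ([set x] \in cliques A) = (x \in A).
Proof.
apply/cliquesP/idP; first by rewrite sub1set => -[].
move=> xA; rewrite sub1set; split=> // y z; rewrite !inE => /eqP-> /eqP->.
by rewrite eqxx.
Qed.

Lemma link_cliques A x : x \in A -> link (cliques A) [set x] = cliques (unit_sphere A x).
Proof.
move=> xA; apply/setP=> s; rewrite inE disjoints1.
apply/andP/cliquesP=> [[xs /cliquesP[]]|[sS cl]].
  rewrite subUset => /andP[_ sA] cl; split=> [|y z ys zs]; last first.
    by apply: cl; rewrite inE ?ys ?zs orbT.
  apply/subsetP=> y ys; rewrite inE (subsetP sA) //= cl ?inE ?eqxx ?ys ?orbT //.
  by apply: contraNneq xs => ->.
have sxy y : y \in s -> (y \in A) && adj x y by move/(subsetP sS); rewrite inE.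
split; first by apply/negP=> /sxy; rewrite adj_irrefl andbF.
apply/cliquesP; split.
  by rewrite subUset sub1set xA; apply/subsetP=> y /sxy/andP[].
move=> y z; rewrite !inE => /orP[/eqP->|ys] /orP[/eqP->|zs].
- by rewrite eqxx.
- by case/andP: (sxy z zs).
- by rewrite adj_sym; case/andP: (sxy y ys).
exact: cl.
Qed.

Lemma deletion_cliques A x : deletion (cliques A) x = cliques (A :\ x).
Proof. by apply/setP=> s; rewrite !inE subsetD1 andbAC. Qed.

(** Links and deletions in clique complexes are the clique complexes of unit spheres and of vertex
    removals, so a contraction translates step by step. *)
Lemma nonevasive_cliques A : contractible A -> nonevasive (cliques A).
Proof.
elim=> {A} [x|A x xA _ IHs _ IHd]; last first.
  by apply: (@nonevasive_step _ _ x); rewrite ?set1_cliques ?link_cliques ?deletion_cliques.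
apply: (@nonevasive_cone _ _ x); first exact: cliques_complex.
  by rewrite set1_cliques inE.
move=> s /cliquesP[sx _]; rewrite (setUidPl sx).
by rewrite set1_cliques inE.
Qed.

Lemma csphere_cliques n A : sphere_succ n A -> csphere n (cliques A).
Proof.
elim: n A => [|n IHn] A /=.
  move=> ->; apply/setP=> s; rewrite !inE subset0; apply: andb_idr => /eqP->.
  by apply/forall_inP=> x; rewrite inE.
case=> -[/eqP/set0Pn[x xA] sS] cD; split; first by exists x; rewrite set1_cliques.
move=> y; rewrite set1_cliques => yA; rewrite link_cliques // deletion_cliques.
by split; [apply/IHn/sS | apply/nonevasive_cliques/cD].
Qed.

Lemma is_simplexE s : is_simplex s = (s != set0) && (s \in cliques [set: G]).
Proof. by rewrite inE subsetT. Qed.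

(** The clique complex of G need not be a sphere, but the link of a vertex v of s is one, and the
    link of s is the link of [s :\ v] inside it. *)
Lemma csphere_link_simplex k s : geometric k G -> is_simplex s ->
  #|s| <= k.+1 /\ csphere (k.+1 - #|s|) (link (cliques [set: G]) s).
Proof.
rewrite is_simplexE => -[_ sph] /andP[/set0Pn[v vs] cl].
have := csphere_cliques (sph v (in_setT v)); rewrite -link_cliques ?inE // => lk.
have dv : [disjoint [set v] & s :\ v] by rewrite disjoints1 !inE eqxx.
have cv : [set v] \in cliques [set: G] by rewrite set1_cliques inE.
have [] := csphere_link (link_complex (cliques_complex _) cv) lk (s := s :\ v).
  by rewrite inE dv setD1K.
by rewrite link_link // setD1K // [#|s|](cardsD1 v) vs add1n ltnS subSS.
Qed.

End Cliques.

(** * Unit spheres of the product graph *)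

Section Product.
Variables G H : sgraph.
Implicit Types (p q : prod_graph G H) (s : {set G + H}).

Let K := cjoin (cliques [set: G]) (cliques [set: H]).

(** Places x and y side by side as a face of the join K, so that the order on pairs becomes
    inclusion. The labels are exactly the faces with both parts nonempty. *)
Definition pair_set p : {set G + H} := sum_set (val p.1) (val p.2).

Lemma sub_pairE p q : sub_pair p q = (pair_set p \subset pair_set q).
Proof. by rewrite sub_sum_set !left_sum_set !right_sum_set. Qed.

Lemma pair_set_inclusion : inclusion_graph [set: prod_graph G H] pair_set.
Proof.
split=> [p q _ _ eq_pq|p q _ _]; last by rewrite -!sub_pairE.
case: p q eq_pq => [x y] [x' y'] eq_pq.
have := congr1 (@right_part _ _) eq_pq; have := congr1 (@left_part _ _) eq_pq.
by rewrite !left_sum_set !right_sum_set /= => /val_inj-> /val_inj->.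
Qed.

Lemma pair_set_ex s : is_simplex (left_part s) -> is_simplex (right_part s) ->
  exists2 p, p \in [set: prod_graph G H] & pair_set p = s.
Proof.
move=> sl sr; exists (Sub _ sl : simplex G, Sub _ sr : simplex H); first by rewrite inE.
exact: sum_set_eta.
Qed.

Lemma pair_setK p : pair_set p \in K.
Proof.
rewrite inE left_sum_set right_sum_set.
by have := valP p.1; have := valP p.2; rewrite !is_simplexE => /andP[_ ->] /andP[_ ->].
Qed.

Lemma cliques_join_complex : complex K.
Proof. by apply: cjoin_complex; apply: cliques_complex. Qed.

(** A face of K above the label of p inherits nonempty parts from it, hence is itself the label of a
    pair. *)
Lemma prod_upper p :
  subdivides [set q in [set: prod_graph G H] | pair_set p \proper pair_set q]
    (fun q => pair_set q :\: pair_set p) (link K (pair_set p)).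
Proof.
apply: subdivides_upper pair_set_inclusion _ _ => [q _|t]; first exact: pair_setK.
rewrite inE => /andP[tl tr] /proper_sub; rewrite sub_sum_set left_sum_set right_sum_set.
case/andP=> pl pr; apply: pair_set_ex; rewrite is_simplexE ?tl ?tr andbT -subset0.
  apply: contraTN (valP p.1) => /(subset_trans pl).
  by rewrite is_simplexE subset0 => ->.
apply: contraTN (valP p.2) => /(subset_trans pr).
by rewrite is_simplexE subset0 => ->.
Qed.

(* Passing to complements reverses the order, and turns the proper faces of a
   product of two simplices into the nonempty faces of the join of their
   boundaries. *)
Lemma prod_lower p :
  subdivides [set q in [set: prod_graph G H] | pair_set q \proper pair_set p]
    (fun q => pair_set p :\: pair_set q) (cjoin (boundary (val p.1)) (boundary (val p.2))).
Proof.
have properD (T : finType) (a b : {set T}) : a != set0 -> a \subset b ->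
    b :\: a \proper b.
  move=> a0 ab; rewrite properE subsetDl; apply: contra a0 => /(subset_trans ab).
  by rewrite subsetD -setI_eq0 setIid => /andP[].
have simplexD (F : sgraph) (x : simplex F) (t : {set F}) : t \proper val x ->
    is_simplex (val x :\: t).
  have := valP x; rewrite !is_simplexE properE => /andP[_ cl] /andP[_ nsub].
  rewrite setD_eq0 nsub /=.
  by apply: (cliques_complex _).2 cl; apply: subsetDl.
apply: subdivides_complement pair_set_inclusion _ _ => [q _ /proper_sub|t].
  rewrite sub_sum_set !left_sum_set !right_sum_set => /andP[ql qr].
  rewrite inE left_partD right_partD !left_sum_set !right_sum_set !inE.
  have [] := (valP q.1, valP q.2); rewrite !is_simplexE => /andP[q10 _] /andP[q20 _].
  by rewrite !properD.
rewrite inE !inE => /andP[tl tr] _; split.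
  by rewrite sub_sum_set left_sum_set right_sum_set !proper_sub.
(* Each part of t is a proper subset, so its complement is a nonempty clique. *)
apply: pair_set_ex; rewrite ?left_partD ?right_partD ?left_sum_set ?right_sum_set.
  exact: simplexD.
exact: simplexD.
Qed.

End Product.

Theorem theorem6 (k l : nat) (G H : sgraph) :
  geometric k G -> geometric l H -> geometric (k + l) (prod_graph G H).
Proof.
move=> geoG geoH; split.
  have [/eqP/set0Pn[x _] _] := geoG; have [/eqP/set0Pn[y _] _] := geoH.
  have sx (F : sgraph) (z : F) : is_simplex [set z].
    rewrite is_simplexE set1_cliques inE andbT.
    by apply/set0Pn; exists z; rewrite inE.
  apply/eqP/set0Pn; exists (Sub _ (sx G x) : simplex G, Sub _ (sx H y) : simplex H).
  by rewrite inE.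
move=> p pT; rewrite (unit_sphere_inclusion (pair_set_inclusion G H) pT).
have [sx sy] := (valP p.1, valP p.2).
have [cx lkx] := csphere_link_simplex geoG sx.
have [cy lky] := csphere_link_simplex geoH sy.
have x0 : val p.1 != set0 by move: sx; rewrite is_simplexE => /andP[].
have y0 : val p.2 != set0 by move: sy; rewrite is_simplexE => /andP[].
have px : #|val p.1| = #|val p.1|.-1.+1 by rewrite prednK // card_gt0.
have py : #|val p.2| = #|val p.2|.-1.+1 by rewrite prednK // card_gt0.
(* The boundaries have index one less than the sizes of x and y, and the links have the indices
   given by [csphere_link_simplex]; [cx] and [cy] make the truncated subtractions cancel. *)
have -> : k + l = (#|val p.1|.-1 + #|val p.2|.-1) + (k.+1 - #|val p.1| + (l.+1 - #|val p.2|)).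
  move: cx cy; rewrite px py /= !ltnS !subSS => cx cy.
  by rewrite addnACA !subnKC.
apply: sphere_succ_join.
- apply: sphere_subdivides (prod_lower p); last first.
    by apply: cjoin_complex; apply: boundary_complex.
  by apply: csphere_cjoin; (exact: boundary_complex || exact: csphere_boundary).
- apply: sphere_subdivides (prod_upper p); last first.
    by apply: link_complex; [apply: cliques_join_complex | apply: pair_setK].
  rewrite link_cjoin left_sum_set right_sum_set.
  apply: csphere_cjoin => //; apply: link_complex; try exact: cliques_complex.
    by move: sx; rewrite is_simplexE => /andP[].
  by move: sy; rewrite is_simplexE => /andP[].
move=> a b /setIdP[_ ap] /setIdP[_ pb].
have ab := proper_trans ap pb.
rewrite (pair_set_inclusion G H).2 ?inE // (proper_sub ab) andbT.
by apply: contraTneq ab => ->; rewrite properxx.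
Qed.
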